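(* Let $n\ge3$ and let $P$ be a positive-area local optimum. The hybrid operator $G_{\mathrm{hyb}}=I_2\otimes G_{\mathrm{sh}}+P_{\mathrm{tight}}$ on $\mathbb R^n\oplus\mathbb R^n$ is positive semidefinite and $$\ker G_{\mathrm{hyb}}=(K_{\mathrm{sh}}(P)\oplus K_{\mathrm{sh}}(P))\cap\ker J^{\mathrm{tr}}_{\mathrm{tight}} .$$
   Context: A configuration is $P=(p_1,\dots,p_n)$ with $p_i=(x_i,y_i)\in[0,1]^2$. For a triple $t=(i,j,k)$, $i<j<k$, put $D_t(P)=\det(p_j-p_i,p_k-p_i)$, $A_t(P)=\tfrac12|D_t(P)|$, and $\delta(P)=\min_tA_t(P)$. A positive-area local optimum is a local maximizer $P$ of $\delta$ on $([0,1]^2)^n$ with $\Delta:=\delta(P)>0$. Triangle $t$ is tight if $A_t(P)=\Delta$. Put $s_t=\operatorname{sgn}D_t(P)$; near $P$, $A_t=\tfrac12s_tD_t$, which is used for derivatives. A normalized KKT multiplier at $P$ is a tuple $q=(\lambda,\ell,r,d,u)$ of nonnegative reals $\lambda_t$ (all triples $t$), $\ell_i,r_i,d_i,u_i$ ($i\in[n]$) with: $\lambda_t=0$ unless $t$ is tight; $\ell_i=0$ unless $x_i=0$, $r_i=0$ unless $x_i=1$, $d_i=0$ unless $y_i=0$, $u_i=0$ unless $y_i=1$; $\sum_t\lambda_t=1$; and $\sum_t\lambda_t\nabla_{p_i}A_t(P)+(\ell_i-r_i,d_i-u_i)=0$ for all $i$. The set of these is the KKT polytope $\mathcal K(P)$.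 For $t=(i,j,k)$, $i<j<k$, let $B_t=s_t(a_tc_t^T-c_ta_t^T)\in\mathbb R^{n\times n}$ with $a_t=e_j-e_i$, $c_t=e_k-e_i$. For $q\in\mathcal K(P)$ let $B(q)=\sum_t\lambda_tB_t$. The shared kernel is $K_{\mathrm{sh}}(P)=\bigcap_{q\in\mathcal K(P)}\ker B(q)$. Let $C_1,\dots,C_s$ be a Frobenius-orthonormal basis of $\operatorname{span}\{B(q):q\in\mathcal K(P)\}$ and $G_{\mathrm{sh}}=\sum_\alpha C_\alpha^TC_\alpha$ (independent of the basis). Velocities are elements $v=(\xi,\eta)$ of $\mathbb R^n\oplus\mathbb R^n$ (first and second coordinates), $v_i=(\xi_i,\eta_i)$. $J=J^{\mathrm{tr}}_{\mathrm{tight}}$ is the matrix (linear map on $\mathbb R^n\oplus\mathbb R^n$) whose rows are: $v\mapsto DA_t(P)[v]$ for all tight triangles $t$; $v\mapsto\xi_i-\xi_j$ for all $i,j$ with $x_i,x_j\in\{0,1\}$ (points on the vertical sides); and $v\mapsto\eta_i-\eta_j$ for all $i,j$ with $y_i,y_j\in\{0,1\}$ (points on the horizontal sides). $P_{\mathrm{tight}}=J^T(JJ^T)^+J$ ($^+$ the Moore–Penrose inverse) is the orthogonal projector onto the row space of $J$. $I_2\otimes G_{\mathrm{sh}}$ acts by $(\xi,\eta)\mapsto(G_{\mathrm{sh}}\xi,G_{\mathrm{sh}}\eta)$. *)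

(* Defs.v *)
From HB Require Import structures.
From mathcomp Require Import all_boot all_order all_algebra.
From mathcomp Require Import all_classical all_reals all_analysis.

Set Implicit Arguments.
Unset Strict Implicit.
Unset Printing Implicit Defensive.

Import Order.TTheory GRing.Theory Num.Theory.
Import numFieldNormedType.Exports.

Local Open Scope classical_set_scope.
Local Open Scope ring_scope.

(* A configuration, like a velocity, is an element of R^n (+) R^n stored as a
   column of length n + n: the first n entries are the first coordinates
   of the n points (resp. velocities), the last n the second coordinates. *)

Definition vec2 (R : realType) (a b : R) : 'cV[R]_2 :=
  \col_c (if c == 0 then a else b).

Definition xc (R : realType) n (P : 'cV[R]_(n + n)) (i : 'I_n) : R :=
  P (lshift n i) 0.
Definition yc (R : realType) n (P : 'cV[R]_(n + n)) (i : 'I_n) : R :=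
  P (rshift n i) 0.
Definition pt (R : realType) n (P : 'cV[R]_(n + n)) (i : 'I_n) : 'cV[R]_2 :=
  vec2 (xc P i) (yc P i).

Definition triple (n : nat) : Type :=
  {t : 'I_n * 'I_n * 'I_n | (t.1.1 < t.1.2 < t.2)%N}.

Definition tri1 n (t : triple n) : 'I_n := (val t).1.1.
Definition tri2 n (t : triple n) : 'I_n := (val t).1.2.
Definition tri3 n (t : triple n) : 'I_n := (val t).2.

Definition Ddet (R : realType) n (t : triple n) (P : 'cV[R]_(n + n)) : R :=
  \det (row_mx (pt P (tri2 t) - pt P (tri1 t))
               (pt P (tri3 t) - pt P (tri1 t)) : 'M[R]_2).

Definition area (R : realType) n (t : triple n) (P : 'cV[R]_(n + n)) : R :=
  2^-1 * `|Ddet t P|.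

Definition delta (R : realType) n (P : 'cV[R]_(n + n)) : R :=
  inf (range (fun t : triple n => area t P)).

(* For n >= 3 there are triples, and the infimum is a minimum. *)
Lemma delta_min (R : realType) n (P : 'cV[R]_(n + n)) : (3 <= n)%N ->
  (exists t : triple n, area t P = delta P) /\
  (forall t : triple n, delta P <= area t P).
Proof.
move=> n3.
have lt1 : (1 < n)%N by apply: leq_trans n3.
have lt0 : (0 < n)%N by apply: leq_trans n3.
pose t0 : triple n :=
  exist _ (Ordinal lt0, Ordinal lt1, Ordinal n3) isT.
have [t1 _ mint1] := @arg_minP _ _ _ t0 xpredT (fun t => area t P) isT.
suff -> : delta P = area t1 P by split=> [|t]; [exists t1 | exact: mint1].
have lbt1 : lbound (range (fun t : triple n => area t P)) (area t1 P).
  by move=> _ [t _ <-]; exact: mint1.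
apply/eqP; rewrite eq_le; apply/andP; split.
  by apply: ge_inf; [exists (area t1 P) | exists t1].
by apply: lb_le_inf => //; exists (area t1 P), t1.
Qed.

Definition in_square (R : realType) n (P : 'cV[R]_(n + n)) : Prop :=
  forall i : 'I_n, 0 <= xc P i <= 1 /\ 0 <= yc P i <= 1.

Definition positive_area_local_optimum (R : realType) n
    (P : 'cV[R]_(n + n)) : Prop :=
  [/\ in_square P,
      \forall Q \near P, in_square Q -> delta Q <= delta P
    & 0 < delta P].

Definition tight (R : realType) n (P : 'cV[R]_(n + n)) : {set triple n} :=
  [set t | area t P == delta P]%SET.

(* The row vector of DA_t(P), in the basis of coordinate directions.  When
   delta P > 0, every area t is differentiable at P. *)
Definition dArea (R : realType) n (t : triple n) (P : 'cV[R]_(n + n)) :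
    'rV[R]_(n + n) :=
  \row_k 'D_(delta_mx k 0) (area t) P.

Definition grad_area (R : realType) n (t : triple n) (P : 'cV[R]_(n + n))
    (i : 'I_n) : 'cV[R]_2 :=
  vec2 (dArea t P 0 (lshift n i)) (dArea t P 0 (rshift n i)).

Record multiplier (R : realType) (n : nat) := Multiplier {
  lam : triple n -> R;
  mleft : 'I_n -> R;
  mright : 'I_n -> R;
  mdown : 'I_n -> R;
  mup : 'I_n -> R
}.

Record is_KKT (R : realType) n (P : 'cV[R]_(n + n)) (q : multiplier R n) :
    Prop := IsKKT {
  lam_ge0 : forall t, 0 <= lam q t;
  bnd_ge0 : forall i,
    [/\ 0 <= mleft q i, 0 <= mright q i, 0 <= mdown q i & 0 <= mup q i];
  lam_tight : forall t, t \notin tight P -> lam q t = 0;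
  left_supp : forall i, xc P i != 0 -> mleft q i = 0;
  right_supp : forall i, xc P i != 1 -> mright q i = 0;
  down_supp : forall i, yc P i != 0 -> mdown q i = 0;
  up_supp : forall i, yc P i != 1 -> mup q i = 0;
  lam_sum1 : \sum_t lam q t = 1;
  stationary : forall i,
    \sum_t lam q t *: grad_area t P i
      + vec2 (mleft q i - mright q i) (mdown q i - mup q i) = 0
}.

Definition KKT_polytope (R : realType) n (P : 'cV[R]_(n + n)) :
  set (multiplier R n) := [set q | is_KKT P q].

Definition ediff (R : realType) n (i j : 'I_n) : 'cV[R]_n :=
  delta_mx j 0 - delta_mx i 0.

Definition Btri (R : realType) n (P : 'cV[R]_(n + n)) (t : triple n) :
    'M[R]_n :=
  let a := ediff R (tri1 t) (tri2 t) in
  let c := ediff R (tri1 t) (tri3 t) in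
  Num.sg (Ddet t P) *: (a *m c^T - c *m a^T).

Definition Bmx (R : realType) n (P : 'cV[R]_(n + n)) (q : multiplier R n) :
    'M[R]_n :=
  \sum_t lam q t *: Btri P t.

Definition mxker (R : realType) m n (M : 'M[R]_(m, n)) : set 'cV[R]_n :=
  [set w | M *m w = 0].

Definition Ksh (R : realType) n (P : 'cV[R]_(n + n)) : set 'cV[R]_n :=
  \bigcap_(q in KKT_polytope P) mxker (Bmx P q).

Definition lin_span (R : realType) m n (S : set 'M[R]_(m, n)) :
    set 'M[R]_(m, n) :=
  [set M | exists (k : nat) (c : 'I_k -> R) (F : 'I_k -> 'M[R]_(m, n)),
     (forall i, S (F i)) /\ M = \sum_i c i *: F i].

Definition frobenius (R : realType) m n (M N : 'M[R]_(m, n)) : R :=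
  \tr (M^T *m N).

Definition frobenius_onb (R : realType) m n s (C : 'I_s -> 'M[R]_(m, n))
    (V : set 'M[R]_(m, n)) : Prop :=
  (forall a b, frobenius (C a) (C b) = (a == b)%:R) /\
  lin_span (range C) = V.

Definition Bspan (R : realType) n (P : 'cV[R]_(n + n)) : set 'M[R]_n :=
  lin_span [set Bmx P q | q in KKT_polytope P].

Definition Gsh (R : realType) n s (C : 'I_s -> 'M[R]_n) : 'M[R]_n :=
  \sum_a (C a)^T *m C a.

(* I_2 (x) G, i.e. (xi, eta) |-> (G xi, G eta). *)
Definition I2tens (R : realType) n (G : 'M[R]_n) : 'M[R]_(n + n) :=
  block_mx G 0 0 G.

Definition vert_pairs (R : realType) n (P : 'cV[R]_(n + n)) :
    {set 'I_n * 'I_n} :=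
  [set ij | (xc P ij.1 \in [:: 0; 1]) && (xc P ij.2 \in [:: 0; 1])]%SET.
Definition horiz_pairs (R : realType) n (P : 'cV[R]_(n + n)) :
    {set 'I_n * 'I_n} :=
  [set ij | (yc P ij.1 \in [:: 0; 1]) && (yc P ij.2 \in [:: 0; 1])]%SET.

Definition Jtight (R : realType) n (P : 'cV[R]_(n + n)) :
    'M[R]_(#|tight P| + (#|vert_pairs P| + #|horiz_pairs P|), n + n) :=
  col_mx
    (\matrix_(a < #|tight P|) dArea (enum_val a) P)
    (col_mx
      (\matrix_(a < #|vert_pairs P|)
         (delta_mx 0 (lshift n (enum_val a).1)
          - delta_mx 0 (lshift n (enum_val a).2)))
      (\matrix_(a < #|horiz_pairs P|)
         (delta_mx 0 (rshift n (enum_val a).1)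
          - delta_mx 0 (rshift n (enum_val a).2)))).

Record penrose (R : realType) m n (A : 'M[R]_(m, n)) (X : 'M[R]_(n, m)) :
    Prop := Penrose {
  penrose1 : A *m X *m A = A;
  penrose2 : X *m A *m X = X;
  penrose3 : (A *m X)^T = A *m X;
  penrose4 : (X *m A)^T = X *m A
}.

Lemma penrose_uniq (R : realType) m n (A : 'M[R]_(m, n)) X Y :
  penrose A X -> penrose A Y -> X = Y.
Proof.
move=> [x1 x2 x3 x4] [y1 y2 y3 y4].
have AXY : A *m X = A *m Y.
  by rewrite -x3 -{1}y1 -(mulmxA (A *m Y)) trmx_mul x3 y3 mulmxA x1.
have XYA : X *m A = Y *m A.
  by rewrite -x4 -{1}y1 -mulmxA mulmxA trmx_mul x4 y4 -mulmxA (mulmxA A) x1.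
by rewrite -x2 XYA -mulmxA AXY mulmxA y2.
Qed.

Lemma gram_unit (R : realType) m n (F : 'M[R]_(m, n)) :
  row_free F -> F *m F^T \in unitmx.
Proof.
move=> freeF; rewrite -row_free_unit -kermx_eq0; apply/eqP/row_matrixP => i.
rewrite row0; set w := row i _.
have wFF : w *m (F *m F^T) = 0.
  by apply/sub_kermxP; rewrite /w row_sub.
have nrm : (w *m F) *m (w *m F)^T = 0.
  by rewrite trmx_mul mulmxA -(mulmxA w) wFF mul0mx.
have wF : w *m F = 0.
  move: (w *m F) nrm => u /matrixP/(_ 0 0); rewrite !mxE.
  under eq_bigr do rewrite [_^T _ _]mxE -expr2.
  move=> /eqP; rewrite psumr_eq0 => [/allP u0|k _]; last exact: sqr_ge0.
  apply/rowP => j; rewrite [RHS]mxE; apply/eqP.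
  by rewrite -sqrf_eq0; apply: (u0 j); rewrite mem_index_enum.
by apply: (row_free_inj freeF); rewrite wF mul0mx.
Qed.

Lemma penrose_exists (R : realType) m n (A : 'M[R]_(m, n)) :
  exists X, penrose A X.
Proof.
have [r [L [F [-> uL uF]]]] : exists r (L : 'M[R]_(m, r)) (F : 'M[R]_(r, n)),
    [/\ A = L *m F, L^T *m L \in unitmx & F *m F^T \in unitmx].
  exists (\rank A), (col_base A), (row_base A); split.
  - by rewrite mulmx_base.
  - rewrite -{2}[col_base A]trmxK; apply: gram_unit.
    by rewrite /row_free mxrank_tr; exact: col_base_full.
  - by apply: gram_unit; exact: row_base_free.
pose IF := invmx (F *m F^T); pose IL := invmx (L^T *m L).
have IF_sym : IF^T = IF by rewrite trmx_inv trmx_mul trmxK.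
have IL_sym : IL^T = IL by rewrite trmx_inv trmx_mul trmxK.
pose X := F^T *m IF *m (IL *m L^T).
have AX : L *m F *m X = L *m IL *m L^T.
  by rewrite /X !mulmxA -(mulmxA L) -(mulmxA L) mulmxV // mulmx1.
have XA : X *m (L *m F) = F^T *m IF *m F.
  by rewrite /X -!mulmxA [L^T *m _]mulmxA [IL *m _]mulmxA mulVmx // mul1mx.
exists X; split.
- rewrite AX -!mulmxA [L^T *m _]mulmxA [IL *m _]mulmxA mulVmx //.
  by rewrite mul1mx.
- rewrite XA /X -!mulmxA [F *m _]mulmxA [IF *m (F *m F^T *m _)]mulmxA mulVmx //.
  by rewrite mul1mx.
- by rewrite AX !trmx_mul trmxK IL_sym mulmxA.
- by rewrite XA !trmx_mul trmxK IF_sym mulmxA.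
Qed.

(* The Moore-Penrose inverse: the unique solution of the Penrose equations. *)
Definition mpinv (R : realType) m n (A : 'M[R]_(m, n)) : 'M[R]_(n, m) :=
  xget 0 [set X | penrose A X].

Lemma mpinvP (R : realType) m n (A : 'M[R]_(m, n)) : penrose A (mpinv A).
Proof. exact: (xgetPex 0 (penrose_exists A)). Qed.

Definition Ptight (R : realType) n (P : 'cV[R]_(n + n)) : 'M[R]_(n + n) :=
  let J := Jtight P in J^T *m mpinv (J *m J^T) *m J.

Definition Ghyb (R : realType) n (P : 'cV[R]_(n + n)) s (C : 'I_s -> 'M[R]_n) :
    'M[R]_(n + n) :=
  I2tens (Gsh C) + Ptight P.

Definition psd (R : realType) n (M : 'M[R]_n) : Prop :=
  M^T = M /\ forall v : 'cV[R]_n, 0 <= (v^T *m M *m v) 0 0.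

Definition dsum (R : realType) n (U V : set 'cV[R]_n) : set 'cV[R]_(n + n) :=
  [set v | U (usubmx v) /\ V (dsubmx v)].

(* Main.v *)
Require Import Defs.
From mathcomp Require Import all_boot all_order all_algebra.
From mathcomp Require Import all_classical all_reals all_analysis.
From mathcomp Require Import ring.

(** A sum of positive semidefinite matrices is positive semidefinite and its
    kernel is the intersection of the kernels of the summands.  This applies to
    [G_sh], a sum of Gram matrices [C_a^T C_a] whose kernels intersect in the
    common kernel of [span {B(q)}], and to [G_hyb]; the projector [P_tight] is
    itself the Gram matrix [P_tight^T P_tight] and has the kernel of [J]. *)

Import Order.TTheory GRing.Theory Num.Theory.

Local Open Scope classical_set_scope.
Local Open Scope ring_scope.

Lemma trmx_mul_self_ge0 {R : realType} {n : nat} (v : 'cV[R]_n) :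
  0 <= (v^T *m v) 0 0.
Proof.
rewrite mxE sumr_ge0 // => i _.
by rewrite [v^T _ _]mxE -expr2 sqr_ge0.
Qed.

(** The [j]-th diagonal entry is the sum of the squares of column [j] of [A], so the diagonal alone
    controls every entry. *)
Lemma trmx_mul_self_eq0 {R : realType} {m n : nat} (A : 'M[R]_(m, n)) :
  (forall j, (A^T *m A) j j = 0) -> A = 0.
Proof.
move=> AA; apply/matrixP => i j; rewrite [RHS]mxE; apply/eqP.
have := AA j; rewrite mxE; under eq_bigr do rewrite [A^T _ _]mxE -expr2.
move=> /eqP; rewrite psumr_eq0 => [/allP A0|k _]; last exact: sqr_ge0.
by rewrite -sqrf_eq0; apply: (A0 i); rewrite mem_index_enum.
Qed.

(** Multiplying on the left by [A^T] gives [(F A)^T (F A) = 0]. *)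
Lemma gram_ker {R : realType} {m n p : nat} (F : 'M[R]_(m, n))
    (A : 'M[R]_(n, p)) :
  F^T *m F *m A = 0 -> F *m A = 0.
Proof.
move=> FFA; apply: trmx_mul_self_eq0 => j.
by rewrite trmx_mul -mulmxA (mulmxA F^T) FFA mulmx0 mxE.
Qed.

Lemma mxker_gram {R : realType} {m n : nat} (F : 'M[R]_(m, n)) :
  mxker (F^T *m F) = mxker F.
Proof.
apply/seteqP; split => v; first exact: gram_ker.
by rewrite /mxker /= -mulmxA => ->; rewrite mulmx0.
Qed.

Lemma psd_gram {R : realType} {m n : nat} (F : 'M[R]_(m, n)) :
  psd (F^T *m F).
Proof.
split=> [|v]; first by rewrite trmx_mul trmxK.
by rewrite mulmxA -mulmxA -trmx_mul trmx_mul_self_ge0.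
Qed.

Lemma psd0 {R : realType} {n : nat} : psd (0 : 'M[R]_n).
Proof. by split=> [|v]; rewrite ?trmx0 // mulmx0 mul0mx mxE. Qed.

Lemma psdD {R : realType} {n : nat} (M N : 'M[R]_n) :
  psd M -> psd N -> psd (M + N).
Proof.
move=> [Ms M0] [Ns N0]; split=> [|v]; first by rewrite linearD /= Ms Ns.
by rewrite mulmxDr mulmxDl mxE addr_ge0.
Qed.

(* With [w = M v], the form at [v - t w] is [- 2 t |w|^2 + t^2 w^T M w], which
   is negative for small [t > 0] unless [w = 0]. *)
Lemma psd_form_eq0 {R : realType} {n : nat} (M : 'M[R]_n) (v : 'cV[R]_n) :
  psd M -> (v^T *m M *m v) 0 0 = 0 -> M *m v = 0.
Proof.
move=> [Ms M0] vMv; apply: trmx_mul_self_eq0 => j; rewrite ord1 {j}.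
set w := M *m v.
have wE : v^T *m M = w^T by rewrite /w trmx_mul Ms.
have wv0 : (w^T *m v) 0 0 = 0 by rewrite -wE.
set a := (w^T *m w) 0 0; set b := (w^T *m M *m w) 0 0.
have b0 : 0 <= b by exact: M0.
have form t : 0 <= t ^+ 2 * b - 2 * t * a.
  suff <- : ((v - t *: w)^T *m M *m (v - t *: w)) 0 0
            = t ^+ 2 * b - 2 * t * a by exact: M0.
  rewrite [(v - t *: w)^T]linearB /= linearZ /= !mulmxBl !mulmxBr -!scalemxAl.
  rewrite -!scalemxAr.
  rewrite -(mulmxA w^T M v) -/w wE /a /b.
  move: (w^T *m v) wv0 (w^T *m w) (w^T *m M *m w) => x x0 y z.
  by rewrite !mxE x0; ring.
have b1 : 0 < b + 1 by rewrite ltr_wpDl.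
(* The minimizer of the form in [t] would be [a / b]; the denominator [b + 1] avoids division by
   zero and still makes the value at most zero, with equality only for [a = 0]. *)
have := form (a / (b + 1)).
have -> : (a / (b + 1)) ^+ 2 * b - 2 * (a / (b + 1)) * a
          = - (a / (b + 1)) ^+ 2 * (b + 2) by field; rewrite gt_eqF.
rewrite mulNr oppr_ge0 pmulr_lle0; last by rewrite ltr_wpDl.
rewrite le_eqVlt ltNge sqr_ge0 orbF sqrf_eq0 mulf_eq0 invr_eq0.
by rewrite (gt_eqF b1) orbF => /eqP.
Qed.

(** If [(M + N) v = 0], the two nonnegative forms at [v] add up to zero, so each vanishes and
    [psd_form_eq0] applies to each. *)
Lemma mxker_psdD {R : realType} {n : nat} (M N : 'M[R]_n) :
  psd M -> psd N -> mxker (M + N) = mxker M `&` mxker N.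
Proof.
move=> psdM psdN; apply/seteqP; split => v /=; rewrite /mxker /=; last first.
  by rewrite mulmxDl => -[-> ->]; rewrite addr0.
move=> MNv.
have /eqP : (v^T *m M *m v) 0 0 + (v^T *m N *m v) 0 0 = 0.
  have := congr1 (fun x => (v^T *m x) 0 0) MNv.
  by rewrite mulmxDl mulmxDr !mulmxA mulmx0 !mxE.
rewrite paddr_eq0; [|exact: psdM.2|exact: psdN.2].
by move=> /andP[/eqP Mv /eqP Nv]; split; exact: psd_form_eq0.
Qed.

Lemma psd_sum {R : realType} {n s : nat} (M : 'I_s -> 'M[R]_n) :
  (forall a, psd (M a)) -> psd (\sum_a M a).
Proof. by move=> psdM; apply: big_ind => //; [exact: psd0|exact: psdD]. Qed.

Lemma mxker_psd_sum {R : realType} {n s : nat} (M : 'I_s -> 'M[R]_n) :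
  (forall a, psd (M a)) -> mxker (\sum_a M a) = \bigcap_a mxker (M a).
Proof.
elim: s M => [|s IH] M psdM.
  rewrite big_ord0; apply/seteqP; split => v; first by move=> _ [].
  by rewrite /mxker /= mul0mx.
rewrite big_ord_recl mxker_psdD //; last by apply: psd_sum.
rewrite IH //; apply/seteqP; split => v.
  by move=> [v0 vs] a _; case: (unliftP ord0 a) => [b|] ->; [exact: vs|].
by move=> vM; split=> [|b _]; exact: vM.
Qed.

(** Allows passing between different generators of one span: it is applied both to the basis [C] and
    to the matrices [B(q)]. *)
Lemma bigcap_mxker_lin_span {R : realType} {m n : nat} (S : set 'M[R]_(m, n)) :
  \bigcap_(M in lin_span S) mxker M = \bigcap_(M in S) mxker M.
Proof.
apply/seteqP; split => v vS M.
  move=> SM; apply: vS; exists 1%N, (fun=> 1), (fun=> M); split=> //.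
  by rewrite big_ord1 scale1r.
move=> [k [c [F [SF ->]]]]; rewrite /mxker /= mulmx_suml big1 // => i _.
by rewrite -scalemxAl (vS _ (SF i)) scaler0.
Qed.

Lemma psd_Gsh {R : realType} {n s : nat} (C : 'I_s -> 'M[R]_n) : psd (Gsh C).
Proof. by apply: psd_sum => a; exact: psd_gram. Qed.

Lemma mxker_Gsh {R : realType} {n s : nat} (C : 'I_s -> 'M[R]_n) :
  mxker (Gsh C) = \bigcap_(M in lin_span (range C)) mxker M.
Proof.
rewrite mxker_psd_sum => [|a]; last exact: psd_gram.
rewrite bigcap_mxker_lin_span bigcap_image.
by apply: eq_bigcapr => a _; exact: mxker_gram.
Qed.

Lemma Ksh_Bspan {R : realType} {n : nat} (P : 'cV[R]_(n + n)) :
  Ksh P = \bigcap_(M in Bspan P) mxker M.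
Proof. by rewrite bigcap_mxker_lin_span bigcap_image. Qed.

Lemma I2tens_mul {R : realType} {n : nat} (G : 'M[R]_n) (v : 'cV[R]_(n + n)) :
  I2tens G *m v = col_mx (G *m usubmx v) (G *m dsubmx v).
Proof.
by rewrite -{1}[v]vsubmxK mul_block_col !mul0mx addr0 add0r.
Qed.

Lemma psd_I2tens {R : realType} {n : nat} (G : 'M[R]_n) :
  psd G -> psd (I2tens G).
Proof.
move=> [Gs G0]; split=> [|v]; first by rewrite tr_block_mx Gs !trmx0.
rewrite -mulmxA I2tens_mul -{1}[v]vsubmxK tr_col_mx mul_row_col !mulmxA.
by rewrite mxE addr_ge0.
Qed.

Lemma mxker_I2tens {R : realType} {n : nat} (G : 'M[R]_n) :
  mxker (I2tens G) = dsum (mxker G) (mxker G).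
Proof.
apply/seteqP; split => v; rewrite /mxker /dsum /= I2tens_mul.
  by move=> /eqP; rewrite col_mx_eq0 => /andP[/eqP ? /eqP ?].
by move=> [-> ->]; rewrite col_mx0.
Qed.

(** The transpose of [mpinv A] also satisfies the Penrose equations of the symmetric matrix [A], so
    uniqueness applies. *)
Lemma mpinv_sym {R : realType} {n : nat} (A : 'M[R]_n) :
  A^T = A -> (mpinv A)^T = mpinv A.
Proof.
move=> As; have [A1 A2 A3 A4] := mpinvP A; set X := mpinv A in A1 A2 A3 A4 *.
(* Passing from [X] to [X^T] exchanges the two symmetric products [A X] and [X A]. *)
have AXt : A *m X^T = X *m A by rewrite -A4 trmx_mul As.
have XtA : X^T *m A = A *m X by rewrite -A3 trmx_mul As.
apply: (@penrose_uniq _ _ _ A); last exact: mpinvP.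
split; rewrite ?AXt ?XtA //.
- by rewrite -AXt -[RHS]As -[in RHS]A1 !trmx_mul As mulmxA.
- by rewrite -XtA -[in RHS]A2 !trmx_mul As mulmxA.
Qed.

(* With [K = J J^T X - 1], the first Penrose equation reads [K J J^T = 0], so
   [K J] is orthogonal to itself. *)
Lemma mul_gram_mpinv {R : realType} {m n : nat} (J : 'M[R]_(m, n)) :
  J *m J^T *m mpinv (J *m J^T) *m J = J.
Proof.
have [A1 _ _ _] := mpinvP (J *m J^T); set X := mpinv _ in A1 *.
pose K := J *m J^T *m X - 1%:M.
have KJJ : K *m J *m J^T = 0 by rewrite -mulmxA mulmxBl mul1mx A1 subrr.
have KJ : J *m J^T *m X *m J - J = K *m J by rewrite mulmxBl mul1mx.
(* The transpose is taken so that the Gram matrix that arises is [(K J) (K J)^T = (K J J^T) K^T],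
   which is zero. *)
apply/eqP; rewrite -subr_eq0 KJ -trmx_eq0; apply/eqP.
apply: trmx_mul_self_eq0 => j.
by rewrite trmxK trmx_mul mulmxA KJJ mul0mx mxE.
Qed.

(** With [X] the symmetric pseudoinverse of [J J^T], the right-hand side is [J^T X (J J^T X J)], and
    the bracket equals [J]. *)
Lemma Ptight_gram {R : realType} {n : nat} (P : 'cV[R]_(n + n)) :
  Ptight P = (Ptight P)^T *m Ptight P.
Proof.
rewrite /Ptight; set J := Jtight P; have JX := mul_gram_mpinv J.
have Xs : (mpinv (J *m J^T))^T = mpinv (J *m J^T).
  by apply: mpinv_sym; rewrite trmx_mul trmxK.
(* The pseudoinverse is generalized so that the occurrences of [J] inside it are out of reach of the
   next rewriting. *)
move: (mpinv _) JX Xs => X JX Xs.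
by rewrite !trmx_mul trmxK Xs -{2}JX !mulmxA.
Qed.

Lemma psd_Ptight {R : realType} {n : nat} (P : 'cV[R]_(n + n)) :
  psd (Ptight P).
Proof. by rewrite Ptight_gram; exact: psd_gram. Qed.

(** Each matrix is a left multiple of the other: [Ptight P] ends in the factor [J], and
    [J = J (J^T X J)] with [X] the pseudoinverse of [J J^T]. *)
Lemma mxker_Ptight {R : realType} {n : nat} (P : 'cV[R]_(n + n)) :
  mxker (Ptight P) = mxker (Jtight P).
Proof.
apply/seteqP; split => v; rewrite /mxker /= /Ptight; set J := Jtight P.
  move=> PTv; rewrite -(mul_gram_mpinv J) -(mulmxA J) -(mulmxA J) -(mulmxA J).
  by rewrite PTv mulmx0.
by rewrite -mulmxA => ->; rewrite mulmx0.
Qed.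

Theorem theorem5p4 (R : realType) (n : nat) (hn : (3 <= n)%N)
    (P : 'cV[R]_(n + n)) (hP : positive_area_local_optimum P)
    (s : nat) (C : 'I_s -> 'M[R]_n) (hC : frobenius_onb C (Bspan P)) :
  psd (Ghyb P C) /\
  mxker (Ghyb P C) = dsum (Ksh P) (Ksh P) `&` mxker (Jtight P).
Proof.
have psdG : psd (I2tens (Gsh C)) by apply: psd_I2tens; exact: psd_Gsh.
split; first by apply: psdD => //; exact: psd_Ptight.
rewrite mxker_psdD //; last exact: psd_Ptight.
(* The kernel of [Gsh C] depends on [C] only through its span, which is that of the [B(q)]. *)
by rewrite mxker_I2tens mxker_Ptight mxker_Gsh hC.2 -Ksh_Bspan.
Qed.
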